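(* Assume that $\nabla_y f(x,y)$ is Lipschitz continuous in $y$ with Lipschitz constant $L_y(f)$, i.e. for any $x$, $\|\nabla_y f(x,y)-\nabla_y f(x,z)\|\le L_y(f)\|y-z\|$ for all $y,z\in\mathbb{R}^M$. Let $0<\rho\le \frac{1}{L_y(f)}$, and let $(x^k,y^k,\bar y^k,\gamma^k)$ be generated by Algorithm APLM-S (defined in the context) with this $\rho$, from any $x^0$, $\bar y^0$ and any $\gamma^0$ with $-\gamma^0\in\partial g(\bar y^0)$. Then for every $k\ge 1$, $$F(x^k,\bar y^k)-F(x^*,y^* )\le \frac{\|\bar y^0-y^*\|^2}{2\rho\,(k+k_n)},$$ where $(x^*,y^* )$ is a minimizer of $F$ over $\mathbb{R}^m\times\mathbb{R}^M$, equivalently $(x,y,\bar y)=(x^*,y^*,y^* )$ is an optimal solution of $\min_{x,y,\bar y}\{f(x,y)+g(\bar y): y=\bar y\}$, and $k_n$ is the number of regular iterations among the first $k$ iterations.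
   Context: Setting. Let $A\in\mathbb{R}^{n\times m}$, $b\in\mathbb{R}^n$, $\lambda>0$, $\mu>0$. Let $\mathcal S$ be a finite family of (possibly overlapping) groups $s\subseteq\{1,\dots,m\}$ and $M=\sum_{s\in\mathcal S}|s|$. Vectors $y\in\mathbb{R}^M$ are partitioned into disjoint blocks $y_s\in\mathbb{R}^{|s|}$, $s\in\mathcal S$. The matrix $C\in\{0,1\}^{M\times m}$ has $C_{i,j}=1$ if the $i$-th coordinate of $y$ is a replicate of $x_j$ and $0$ otherwise, so that $(Cx)_s=x_s$ (the subvector of $x$ indexed by $s$). Fix $v\in\mathbb{R}^M$. $\|\cdot\|$ is the Euclidean norm. Define for $x\in\mathbb{R}^m$, $y,\bar y,\gamma\in\mathbb{R}^M$, $\rho>0$: $$f(x,y)=\tfrac12\|Ax-b\|^2-v^T(Cx-y)+\tfrac{1}{2\mu}\|Cx-y\|^2,\qquad g(y)=\lambda\sum_{s\in\mathcal S}\|y_s\|,$$ $$F(x,y)=f(x,y)+g(y),\qquad \mathcal L_\rho(x,y,\bar y,\gamma)=f(x,y)+g(\bar y)+\gamma^T(\bar y-y)+\tfrac{1}{2\rho}\|\bar y-y\|^2.$$ Algorithm APLM-S. Given $x^0,\bar y^0,v$; choose $\rho>0$ and $\gamma^0$ with $-\gamma^0\in\partial g(\bar y^0)$. For $k=0,1,2,\dots$ ($\arg\min$ denotes a minimizer): 1. $(x^{k+1},y^{k+1})\leftarrow\arg\min_{x,y}\mathcal L_\rho(x,y,\bar y^k,\gamma^k)$. 2. If $F(x^{k+1},y^{k+1})>\mathcal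 L_\rho(x^{k+1},y^{k+1},\bar y^k,\gamma^k)$, then (skipping step) reset $y^{k+1}\leftarrow\bar y^k$ and $x^{k+1}\leftarrow\arg\min_x f(x,y^{k+1})$. 3. $\bar y^{k+1}\leftarrow\arg\min_{\bar y}\mathcal L_\rho\big(x^{k+1},y^{k+1},\bar y,\nabla_y f(x^{k+1},y^{k+1})\big)$. 4. $\gamma^{k+1}\leftarrow\nabla_y f(x^{k+1},y^{k+1})-\frac{y^{k+1}-\bar y^{k+1}}{\rho}$. An iteration is called regular if no skipping step is executed in it, and a skipping iteration otherwise. *)

(* Defs.v *)
From HB Require Import structures.
From mathcomp Require Import all_boot all_order all_algebra.
From mathcomp Require Import all_classical all_reals all_analysis.

Set Implicit Arguments.
Unset Strict Implicit.
Unset Printing Implicit Defensive.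

Import Order.TTheory GRing.Theory Num.Theory.
Import numFieldNormedType.Exports.

Local Open Scope classical_set_scope.
Local Open Scope ring_scope.

(* The library's norm `|u| on matrices is the max norm, hence a separate
   Euclidean norm. *)
Definition dotv (R : realType) (d : nat) (u w : 'cV[R]_d) : R :=
  \sum_(i < d) u i 0 * w i 0.

Definition enorm (R : realType) (d : nat) (u : 'cV[R]_d) : R :=
  Num.sqrt (\sum_(i < d) u i 0 ^+ 2).

Definition gradient (R : realType) (d : nat) (h : 'cV[R]_d -> R)
    (y : 'cV[R]_d) : 'cV[R]_d :=
  \col_(i < d) 'D_(delta_mx i 0) h y.

Definition subdifferential (R : realType) (d : nat) (h : 'cV[R]_d -> R)
    (y : 'cV[R]_d) : set 'cV[R]_d :=
  [set u | forall z, h y + dotv u (z - y) <= h z].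

(* Set-valued: an assignment z <- argmin h is rendered by membership of z. *)
Definition argmin_on (R : realType) (T : Type) (D : set T) (h : T -> R)
    : set T :=
  [set t | D t /\ forall u, D u -> h t <= h u].

Definition argmin (R : realType) (T : Type) (h : T -> R) : set T :=
  argmin_on setT h.

Section APLM_S.
Context (R : realType) (n m p : nat).
Context (A : 'M[R]_(n, m)) (b : 'cV[R]_n) (lambda mu : R).
Context (S : 'I_p -> {set 'I_m}).

(* Vectors of R^M are block vectors; the block y_s is [submxcol y s], whose
   i-th coordinate replicates the i-th smallest index in the group S s. *)
Local Notation M := (\sum_(s < p) #|S s|)%N.

Context (v : 'cV[R]_M).

Definition replicate_mx : 'M[R]_(M, m) :=
  \mxcol_(s < p) \matrix_(i < #|S s|, j < m) (enum_val i == j)%:R.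

Local Notation C := replicate_mx.

Definition smooth_part (x : 'cV[R]_m) (y : 'cV[R]_M) : R :=
  2^-1 * enorm (A *m x - b) ^+ 2 - dotv v (C *m x - y)
  + (2 * mu)^-1 * enorm (C *m x - y) ^+ 2.

Definition group_reg (y : 'cV[R]_M) : R :=
  lambda * \sum_(s < p) enorm (submxcol y s).

Local Notation f := smooth_part.
Local Notation g := group_reg.

Definition objective (x : 'cV[R]_m) (y : 'cV[R]_M) : R := f x y + g y.

Definition aug_lagrangian (rho : R) (x : 'cV[R]_m) (y ybar gamma : 'cV[R]_M)
    : R :=
  f x y + g ybar + dotv gamma (ybar - y)
  + (2 * rho)^-1 * enorm (ybar - y) ^+ 2.

Definition grad_y (x : 'cV[R]_m) (y : 'cV[R]_M) : 'cV[R]_M := gradient (f x) y.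

(* (xt k, yt k) is the pair computed by the first step of iteration k, before
   a possible reset; iteration k produces the iterates of index k.+1. *)
Definition skipping (rho : R) (xt : nat -> 'cV[R]_m)
    (yt ybar gamma : nat -> 'cV[R]_M) (k : nat) : bool :=
  aug_lagrangian rho (xt k) (yt k) (ybar k) (gamma k)
    < objective (xt k) (yt k).

Definition nb_regular (rho : R) (xt : nat -> 'cV[R]_m)
    (yt ybar gamma : nat -> 'cV[R]_M) (k : nat) : nat :=
  #|[set i : 'I_k | ~~ skipping rho xt yt ybar gamma i]%SET|.

(* All possible runs of the algorithm; x 0 and ybar 0 are the arbitrary starting
   points, while y 0 plays no role. *)
Record aplm_s_run (rho : R) (xt : nat -> 'cV[R]_m) (yt : nat -> 'cV[R]_M)
    (x : nat -> 'cV[R]_m) (y ybar gamma : nat -> 'cV[R]_M) : Prop := {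
  aplm_s_init : subdifferential g (ybar 0%N) (- gamma 0%N);
  aplm_s_trial : forall k,
    argmin (fun z : 'cV[R]_m * 'cV[R]_M =>
              aug_lagrangian rho z.1 z.2 (ybar k) (gamma k)) (xt k, yt k);
  aplm_s_regular : forall k, ~~ skipping rho xt yt ybar gamma k ->
    x k.+1 = xt k /\ y k.+1 = yt k;
  aplm_s_skip : forall k, skipping rho xt yt ybar gamma k ->
    y k.+1 = ybar k /\ argmin (fun z => f z (y k.+1)) (x k.+1);
  aplm_s_ybar : forall k,
    argmin (fun z => aug_lagrangian rho (x k.+1) (y k.+1) z
                       (grad_y (x k.+1) (y k.+1))) (ybar k.+1);
  aplm_s_gamma : forall k,
    gamma k.+1 = grad_y (x k.+1) (y k.+1) - rho^-1 *: (y k.+1 - ybar k.+1)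
}.

End APLM_S.

(* Main.v *)
(* Write (x, y, ybar) for the iterates of index k + 1 and D for the gap
   F (x, ybar) - F (xs, ys).  Since x minimizes f (., y), convexity of f and the
   optimality condition of the ybar-step give
     2 rho D <= |y - ys|^2 - |ybar - ys|^2.
   In a skipping iteration y is the previous ybar.  In a regular one the
   optimality condition of the first step gives moreover
     2 rho (F (x, y) - F (xs, ys)) <= |ybar_k - ys|^2 - |y - ys|^2,
   and F (x, ybar) <= F (x, y), so that
     4 rho D <= |ybar_k - ys|^2 - |ybar - ys|^2.
   The gaps decrease along the iteration, and the bounds, with weight 1 or 2,
   telescope. *)
Require Import Defs.
From HB Require Import structures.
From mathcomp Require Import all_boot all_order all_algebra.
From mathcomp Require Import zify ring lra.
From mathcomp Require Import all_classical all_reals all_analysis.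

Set Implicit Arguments.
Unset Strict Implicit.
Unset Printing Implicit Defensive.

Import Order.TTheory GRing.Theory Num.Theory.
Import numFieldNormedType.Exports.

Local Open Scope classical_set_scope.
Local Open Scope ring_scope.


(** * Euclidean geometry, first-order conditions and subgradients *)

Section EuclideanSpace.
Context (R : realType).

(** Divide by [t] and let [t] tend to 0. Every first-order optimality condition below is obtained
    this way, by comparing a minimizer with nearby points of a segment. *)
Lemma nonneg_slope (a c : R) :
  (forall t, 0 < t -> t <= 1 -> 0 <= t * a + t ^+ 2 * c) -> 0 <= a.
Proof.
move=> H; rewrite leNgt; apply/negP => a_lt0.
have c1_gt0 : 0 < `|c| + 1 by rewrite ltr_wpDl.
(* Small enough that [t * c <= - a / 2], which leaves [a + t * c] negative. *)
pose t := Num.min 1 (- a / (2 * (`|c| + 1))).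
have t_gt0 : 0 < t by rewrite lt_min ltr01 divr_gt0 ?oppr_gt0 ?mulr_gt0.
have t_le1 : t <= 1 by rewrite ge_min lexx.
have t_le : t * (2 * (`|c| + 1)) <= - a.
  by rewrite -ler_pdivlMr ?mulr_gt0 // ge_min lexx orbT.
have c_le : c <= `|c| := ler_norm c.
have := H t t_gt0 t_le1.
rewrite expr2 -mulrA -mulrDr pmulr_rge0 // => ac_ge0.
have : t * c <= t * `|c| by rewrite ler_pM2l.
have : 0 <= t * `|c| by rewrite mulr_ge0 // ltW.
lra.
Qed.

Section Dot.
Context (d : nat).
Implicit Types (u w z : 'cV[R]_d) (t : R).

Lemma dotvC u w : dotv u w = dotv w u.
Proof. by apply: eq_bigr => i _; rewrite mulrC. Qed.

Lemma dotvDr u w z : dotv u (w + z) = dotv u w + dotv u z.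
Proof. by rewrite -big_split /=; apply: eq_bigr => i _; rewrite mxE mulrDr. Qed.

Lemma dotvZr u t w : dotv u (t *: w) = t * dotv u w.
Proof. by rewrite /dotv mulr_sumr; apply: eq_bigr => i _; rewrite mxE mulrCA. Qed.

Lemma dotvNr u w : dotv u (- w) = - dotv u w.
Proof. by rewrite -scaleN1r dotvZr mulN1r. Qed.

Lemma dotvBr u w z : dotv u (w - z) = dotv u w - dotv u z.
Proof. by rewrite dotvDr dotvNr. Qed.

Lemma dotvDl u w z : dotv (u + w) z = dotv u z + dotv w z.
Proof. by rewrite !(dotvC _ z) dotvDr. Qed.

Lemma dotvZl t u w : dotv (t *: u) w = t * dotv u w.
Proof. by rewrite !(dotvC _ w) dotvZr. Qed.

Lemma dotvNl u w : dotv (- u) w = - dotv u w.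
Proof. by rewrite !(dotvC _ w) dotvNr. Qed.

Lemma dotvBl u w z : dotv (u - w) z = dotv u z - dotv w z.
Proof. by rewrite dotvDl dotvNl. Qed.

Lemma dotv0r u : dotv u 0 = 0.
Proof. by rewrite -(scale0r (0 : 'cV[R]_d)) dotvZr mul0r. Qed.

Lemma dotv_delta u i : dotv u (delta_mx i 0) = u i 0.
Proof.
rewrite /dotv (bigD1 i) //= big1 ?addr0 => [|k k_neq]; last first.
  by rewrite [delta_mx _ _ _ _]mxE (negPf k_neq) mulr0.
by rewrite [delta_mx _ _ _ _]mxE !eqxx mulr1.
Qed.

Lemma enorm_sqr u : enorm u ^+ 2 = dotv u u.
Proof.
rewrite sqr_sqrtr; first by apply: eq_bigr => i _; rewrite expr2.
by apply: sumr_ge0 => i _; exact: sqr_ge0.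
Qed.

Lemma enorm_ge0 u : 0 <= enorm u.
Proof. exact: sqrtr_ge0. Qed.

Lemma enorm_opp u : enorm (- u) = enorm u.
Proof. by congr Num.sqrt; apply: eq_bigr => i _; rewrite mxE sqrrN. Qed.

Lemma enorm0 : enorm (0 : 'cV[R]_d) = 0.
Proof. by rewrite /enorm big1 ?sqrtr0 // => i _; rewrite mxE expr0n. Qed.

Lemma enormZ t u : enorm (t *: u) = `|t| * enorm u.
Proof.
rewrite /enorm -sqrtr_sqr -sqrtrM ?sqr_ge0 //; congr Num.sqrt.
by rewrite mulr_sumr; apply: eq_bigr => i _; rewrite mxE exprMn.
Qed.

Lemma enorm_sqrDZ u t w :
  enorm (u + t *: w) ^+ 2
  = enorm u ^+ 2 + t * (2 * dotv u w) + t ^+ 2 * enorm w ^+ 2.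
Proof.
by rewrite !enorm_sqr dotvDl !dotvDr !dotvZl !dotvZr (dotvC w u); ring.
Qed.

Lemma enorm_sqrD u w :
  enorm (u + w) ^+ 2 = enorm u ^+ 2 + 2 * dotv u w + enorm w ^+ 2.
Proof. by rewrite -[w in LHS]scale1r enorm_sqrDZ; ring. Qed.

(** Cauchy-Schwarz, by expanding the squared norm of [enorm w *: u - enorm u *: w]; the expansion is
    informative only when both norms are positive. *)
Lemma dotv_le_enorm u w : dotv u w <= enorm u * enorm w.
Proof.
(* Without its constant term, the square of [u' - t *: w'] can stay nonnegative for small [t] only
   if its slope is nonnegative. *)
have degenerate u' w' : enorm u' = 0 -> dotv u' w' <= 0.
  move=> u0; rewrite -oppr_ge0.
  apply: (@nonneg_slope _ (2^-1 * enorm w' ^+ 2)) => t _ _.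
  have := sqr_ge0 (enorm (u' + (- t) *: w')).
  by rewrite enorm_sqrDZ u0 expr0n /= sqrrN; lra.
have := enorm_ge0 u; rewrite le_eqVlt => /orP[/eqP/esym u0|u_gt0].
  by rewrite u0 mul0r degenerate.
have := enorm_ge0 w; rewrite le_eqVlt => /orP[/eqP/esym w0|w_gt0].
  by rewrite w0 mulr0 dotvC degenerate.
rewrite -subr_ge0 -(@pmulr_rge0 _ (2 * (enorm u * enorm w))) ?mulr_gt0 //.
have := sqr_ge0 (enorm (enorm w *: u + (- enorm u) *: w)).
rewrite enorm_sqrDZ enormZ gtr0_norm // dotvZl.
by congr (0 <= _); ring.
Qed.

Lemma enorm_triangle u w : enorm (u + w) <= enorm u + enorm w.
Proof.
rewrite -(@ler_pXn2r _ 2) ?nnegrE ?addr_ge0 ?enorm_ge0 // enorm_sqrD.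
have := dotv_le_enorm u w; lra.
Qed.

End Dot.

Lemma three_point_identity d (u w z : 'cV[R]_d) :
  enorm (u - z) ^+ 2
  = enorm (u - w) ^+ 2 + 2 * dotv (u - w) (w - z) + enorm (w - z) ^+ 2.
Proof. by rewrite -enorm_sqrD addrA subrK. Qed.

(** The difference quotient at [t != 0] is exactly [a + t * c]. *)
Lemma derive_quadratic (V : normedModType R) (h : V -> R) (y w : V) (a c : R) :
  (forall t, h (y + t *: w) = h y + t * a + t ^+ 2 * c) -> 'D_w h y = a.
Proof.
move=> hE; apply: cvg_lim => //.
have slope_cvg : (fun t : R => a + t * c) t @[t --> 0^'] --> a.
  apply: cvg_within_filter.
  suff : (fun t : R => a + t * c) t @[t --> 0] --> a + 0 * c.
    by rewrite mul0r addr0.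
  by apply: cvgD; [exact: cvg_cst|apply: cvgMr_tmp; exact: cvg_id].
apply: cvg_trans slope_cvg; apply: near_eq_cvg.
near=> t; have t_neq0 : t != 0 by near: t; exact: nbhs_dnbhs_neq.
rewrite /= [_ *: w + y]addrC hE /GRing.scale /=; field.
Unshelve. all: by end_near.
Qed.

(** Optimality condition of a proximal step: compare [u] with [u + t *: (z - u)], bound [h] there by
    convexity, and keep the terms of first order in [t]. *)
Lemma prox_subdifferential d (h : 'cV[R]_d -> R) (c : R) (G y u : 'cV[R]_d) :
  (forall w z t, 0 < t -> t <= 1 ->
     h (w + t *: (z - w)) <= h w + t * (h z - h w)) ->
  argmin (fun z => h z + dotv G (z - y) + c * enorm (z - y) ^+ 2) u ->
  subdifferential h u (- (G + (2 * c) *: (u - y))).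
Proof.
move=> h_convex [_ u_min] z /=.
rewrite -subr_ge0.
apply: (@nonneg_slope _ (c * enorm (z - u) ^+ 2)) => t t_gt0 t_le1.
have := u_min (u + t *: (z - u)) I.
have := h_convex u z t t_gt0 t_le1.
rewrite [u + _ - y]addrAC; set e := z - u; set q := u - y.
rewrite enorm_sqrDZ [dotv G (q + _)]dotvDr dotvZr dotvNl dotvDl dotvZl; lra.
Qed.

End EuclideanSpace.

(** * Exact expansions of the quadratic part and convexity of both parts *)

Section Objective.
Context (R : realType) (n m p : nat).
Context (A : 'M[R]_(n, m)) (b : 'cV[R]_n) (lambda mu : R).
Context (S : 'I_p -> {set 'I_m}).

Local Notation M := (\sum_(s < p) #|S s|)%N.

Context (v : 'cV[R]_M).

Local Notation C := (replicate_mx R S).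
Local Notation f := (smooth_part A b mu v).
Local Notation g := (@group_reg R m p lambda S).
Local Notation grad := (grad_y A b mu v).

Implicit Types (x dx : 'cV[R]_m) (y dy : 'cV[R]_M).

(** Directional derivative of [f] at [(x, y)] along [(dx, dy)]. *)
Definition smooth_slope x y dx dy : R :=
  dotv (A *m x - b) (A *m dx)
  + dotv (v + mu^-1 *: (y - C *m x)) (dy - C *m dx).

(** Half the second derivative of [f] along [(dx, dy)]; as [f] is quadratic, it does not depend on
    the base point. *)
Definition smooth_curvature dx dy : R :=
  2^-1 * enorm (A *m dx) ^+ 2 + (2 * mu)^-1 * enorm (C *m dx - dy) ^+ 2.

Lemma smooth_part_line x y dx dy t :
  f (x + t *: dx) (y + t *: dy)
  = f x y + t * smooth_slope x y dx dy + t ^+ 2 * smooth_curvature dx dy.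
Proof.
rewrite /smooth_part /smooth_slope /smooth_curvature !mulmxDr -!scalemxAr.
have -> : A *m x + t *: (A *m dx) - b = A *m x - b + t *: (A *m dx).
  by rewrite addrAC.
have -> : C *m x + t *: (C *m dx) - (y + t *: dy)
          = C *m x - y + t *: (C *m dx - dy).
  by rewrite scalerBr opprD addrACA.
rewrite -[y - _]opprB -[dy - _]opprB.
set r := A *m x - b; set e := C *m x - y; set de := C *m dx - dy.
rewrite !enorm_sqrDZ [dotv v (_ + _)]dotvDr dotvZr dotvNr dotvDl dotvZl dotvNl.
by rewrite invfM; lra.
Qed.

Lemma grad_yE x y : grad x y = v + mu^-1 *: (y - C *m x).
Proof.
apply/matrixP => i j; rewrite ord1 mxE.
rewrite (@derive_quadratic _ _ _ _ _ (smooth_slope x y 0 (delta_mx i 0))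
  (smooth_curvature 0 (delta_mx i 0))) => [|t].
  by rewrite /smooth_slope !mulmx0 subr0 dotv0r add0r dotv_delta.
by rewrite -smooth_part_line scaler0 addr0.
Qed.

Lemma smooth_slopeE x y dx dy :
  smooth_slope x y dx dy = smooth_slope x y dx 0 + dotv (grad x y) dy.
Proof.
by rewrite grad_yE /smooth_slope sub0r dotvBr dotvNr; ring.
Qed.

Lemma smooth_slope0 x y dy : smooth_slope x y 0 dy = dotv (grad x y) dy.
Proof.
by rewrite smooth_slopeE /smooth_slope !mulmx0 subr0 !dotv0r !add0r.
Qed.

Lemma smooth_partE x y x' y' :
  f x' y' = f x y + smooth_slope x y (x' - x) (y' - y)
            + smooth_curvature (x' - x) (y' - y).
Proof.
have := smooth_part_line x y (x' - x) (y' - y) 1.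
by rewrite !scale1r ![_ + (_ - _)]addrC !subrK => ->; ring.
Qed.

Lemma smooth_part_yE x y z :
  f x z = f x y + dotv (grad x y) (z - y) + (2 * mu)^-1 * enorm (z - y) ^+ 2.
Proof.
rewrite (smooth_partE x y) subrr smooth_slope0 /smooth_curvature !mulmx0 sub0r.
by rewrite enorm_opp enorm0; ring.
Qed.

Lemma smooth_curvature_ge0 dx dy : 0 < mu -> 0 <= smooth_curvature dx dy.
Proof.
by move=> mu_gt0; rewrite addr_ge0 // mulr_ge0 ?sqr_ge0 // invr_ge0 ?mulr_ge0 // ltW.
Qed.

(** Convexity gives a lower bound by the full linearization; its [x] part is nonnegative because [x]
    minimizes [f] at fixed [y]. *)
Lemma smooth_part_stationary_le x y x' y' : 0 < mu ->
  argmin (fun z => f z y) x ->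
  f x y + dotv (grad x y) (y' - y) <= f x' y'.
Proof.
move=> mu_gt0 [_ x_min]; rewrite (smooth_partE x y x' y') smooth_slopeE.
have : 0 <= smooth_slope x y (x' - x) 0.
  apply: (@nonneg_slope _ _ (smooth_curvature (x' - x) 0)) => t _ _.
  have := smooth_part_line x y (x' - x) 0 t.
  have := x_min (x + t *: (x' - x)) I; rewrite scaler0 addr0; lra.
have := smooth_curvature_ge0 (x' - x) (y' - y) mu_gt0; lra.
Qed.

Lemma group_reg_convex (w z : 'cV[R]_M) t : 0 <= lambda -> 0 < t -> t <= 1 ->
  g (w + t *: (z - w)) <= g w + t * (g z - g w).
Proof.
move=> lambda_ge0 t_gt0 t_le1.
have -> : g w + t * (g z - g w) = lambda *
    \sum_(s < p) ((1 - t) * enorm (submxcol w s) + t * enorm (submxcol z s)).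
  by rewrite big_split /= -!mulr_sumr /group_reg; ring.
rewrite ler_wpM2l // ler_sum // => s _.
have -> : submxcol (w + t *: (z - w)) s
          = (1 - t) *: submxcol w s + t *: submxcol z s.
  by apply/matrixP => i j; rewrite !mxE; ring.
by rewrite (le_trans (enorm_triangle _ _)) // !enormZ !ger0_norm ?subr_ge0 // ltW.
Qed.

End Objective.

(** * Estimates for one iteration and their summation *)

Section Convergence.
Context (R : realType) (n m p : nat).
Context (A : 'M[R]_(n, m)) (b : 'cV[R]_n) (lambda mu : R).
Context (S : 'I_p -> {set 'I_m}).

Local Notation M := (\sum_(s < p) #|S s|)%N.

Context (v : 'cV[R]_M) (rho : R).

Local Notation f := (smooth_part A b mu v).
Local Notation g := (@group_reg R m p lambda S).
Local Notation F := (objective A b lambda mu v).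
Local Notation Lag := (aug_lagrangian A b lambda mu v rho).
Local Notation grad := (grad_y A b mu v).

Context (xt x : nat -> 'cV[R]_m) (yt y ybar gamma : nat -> 'cV[R]_M).
Context (lambda_gt0 : 0 < lambda) (mu_gt0 : 0 < mu) (rho_gt0 : 0 < rho).
Context (run : aplm_s_run A b lambda mu v rho xt yt x y ybar gamma).

(* What the Lipschitz hypothesis and rho <= 1 / L amount to: rho <= mu, except
   when M = 0, where this form still holds. *)
Context (quadratic_bound :
  forall u : 'cV[R]_M, mu^-1 * enorm u ^+ 2 <= rho^-1 * enorm u ^+ 2).

Local Notation skip := (skipping A b lambda mu v rho xt yt ybar gamma).

(** The update of [gamma] is the negative of the subgradient supplied by the optimality of the
    [ybar] step, so the initial condition persists. *)
Lemma gamma_subdifferential k : subdifferential g (ybar k) (- gamma k).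
Proof.
case: k => [|k]; first exact: aplm_s_init run.
have -> : gamma k.+1 = grad (x k.+1) (y k.+1)
                       + (2 * (2 * rho)^-1) *: (ybar k.+1 - y k.+1).
  rewrite (aplm_s_gamma run) -scalerN opprB; congr (_ + _ *: _).
  by field; rewrite gt_eqF.
apply: prox_subdifferential => [w z t|]; first exact/group_reg_convex/ltW.
have [_ ybar_min] := aplm_s_ybar run k; split => // z _.
have := ybar_min z I; rewrite /aug_lagrangian; lra.
Qed.

(** In a regular iteration, the Lagrangian with [yt k] fixed is [f] plus a constant. *)
Lemma x_stationary k : argmin (fun z => f z (y k.+1)) (x k.+1).
Proof.
have [/(aplm_s_skip run)[] //|/(aplm_s_regular run)[-> ->]] := boolP (skip k).
have [_ trial_min] := aplm_s_trial run k; split => // z _.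
have := trial_min (z, yt k) I; rewrite /aug_lagrangian /=; lra.
Qed.

(** Linearizing [f] in its second argument leaves a remainder with factor [(2 * mu)^-1], which the
    proximal term dominates. *)
Lemma objective_le_lagrangian x' y' z : F x' z <= Lag x' y' z (grad x' y').
Proof.
rewrite /objective /aug_lagrangian (smooth_part_yE A b mu v x' y' z).
have := quadratic_bound (z - y'); rewrite !invfM; lra.
Qed.

Lemma lagrangian_diag x' z c : Lag x' z z c = F x' z.
Proof.
rewrite /aug_lagrangian /objective subrr.
by rewrite dotv0r enorm0; ring.
Qed.

Lemma objective_ybar_le k : F (x k.+1) (ybar k.+1) <= F (x k.+1) (y k.+1).
Proof.
apply: le_trans (objective_le_lagrangian _ (y k.+1) _) _.
have [_ /(_ (y k.+1) I)] := aplm_s_ybar run k.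
by rewrite lagrangian_diag.
Qed.

(** The previous pair competes in both branches: [x k] in the reset of a skipping iteration,
    [(x k, ybar k)] in the trial step, whose value bounds [F] when the skipping test fails. *)
Lemma objective_y_le k : F (x k.+1) (y k.+1) <= F (x k) (ybar k).
Proof.
have [sk|reg] := boolP (skip k).
  have [-> [_ /(_ (x k) I)]] := aplm_s_skip run sk.
  by rewrite lerD2r.
have [-> ->] := aplm_s_regular run reg.
move: reg; rewrite /skipping -leNgt => /le_trans; apply.
have [_ /(_ (x k, ybar k) I)] := aplm_s_trial run k.
by rewrite /= lagrangian_diag.
Qed.

(** Sum of three bounds: the majorization of [F], the linear lower bound on [f] at a stationary [x],
    and the subgradient inequality for [g] at [ybar k.+1]. The gradient terms cancel, and the
    three-point identity absorbs the remaining product. *)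
Lemma ybar_gap k xs ys :
  2 * rho * (F (x k.+1) (ybar k.+1) - F xs ys)
  <= enorm (y k.+1 - ys) ^+ 2 - enorm (ybar k.+1 - ys) ^+ 2.
Proof.
rewrite -ler_pdivlMl ?mulr_gt0 // invfM.
have := objective_le_lagrangian (x k.+1) (y k.+1) (ybar k.+1).
have := smooth_part_stationary_le xs ys mu_gt0 (x_stationary k).
have := gamma_subdifferential k.+1 ys; rewrite (aplm_s_gamma run).
rewrite (three_point_identity (y k.+1) (ybar k.+1) ys).
rewrite /aug_lagrangian /objective.
have -> : ys - y k.+1 = - ((y k.+1 - ybar k.+1) + (ybar k.+1 - ys)).
  by rewrite addrA subrK opprB.
rewrite -[ybar k.+1 - y k.+1]opprB -[ys - ybar k.+1]opprB enorm_opp invfM.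
set q := y k.+1 - ybar k.+1; set r := ybar k.+1 - ys.
rewrite !dotvNr [dotv _ (q + r)]dotvDr dotvNl dotvBl dotvZl; lra.
Qed.

Lemma y_gap k xs ys : ~~ skip k ->
  2 * rho * (F (x k.+1) (y k.+1) - F xs ys)
  <= enorm (ybar k - ys) ^+ 2 - enorm (y k.+1 - ys) ^+ 2.
Proof.
move=> reg; have [-> ->] := aplm_s_regular run reg.
move: reg; rewrite /skipping -leNgt => F_le.
rewrite -ler_pdivlMl ?mulr_gt0 // invfM.
(* First-order optimality of the trial pair in the direction of [(xs, ys)]. *)
have slope_ge0 : 0 <= smooth_slope A b mu v (xt k) (yt k) (xs - xt k) (ys - yt k)
    - dotv (gamma k) (ys - yt k) - rho^-1 * dotv (ybar k - yt k) (ys - yt k).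
  apply: (@nonneg_slope _ _ (smooth_curvature A mu (xs - xt k) (ys - yt k)
    + (2 * rho)^-1 * enorm (ys - yt k) ^+ 2)) => t _ _.
  have [_ /(_ (xt k + t *: (xs - xt k), yt k + t *: (ys - yt k)) I)] :=
    aplm_s_trial run k.
  rewrite /aug_lagrangian /= smooth_part_line.
  have -> : ybar k - (yt k + t *: (ys - yt k))
            = ybar k - yt k + (- t) *: (ys - yt k).
    by rewrite opprD addrA scaleNr.
  rewrite enorm_sqrDZ [dotv (gamma k) (_ + _ *: _)]dotvDr dotvZr invfM; lra.
have := smooth_curvature_ge0 A (xs - xt k) (ys - yt k) mu_gt0.
have := gamma_subdifferential k ys.
move: F_le slope_ge0; rewrite [F xs ys]/objective /aug_lagrangian.
rewrite (smooth_partE A b mu v (xt k) (yt k) xs ys).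
rewrite (three_point_identity (ybar k) (yt k) ys) -[yt k - ys]opprB enorm_opp.
have -> : ys - ybar k = (ys - yt k) - (ybar k - yt k) by rewrite opprB addrA subrK.
set q := ybar k - yt k; set r := ys - yt k.
rewrite dotvNl dotvNr [dotv _ (r - q)]dotvBr invfM; lra.
Qed.

Lemma nb_regularS k :
  nb_regular A b lambda mu v rho xt yt ybar gamma k.+1
  = (nb_regular A b lambda mu v rho xt yt ybar gamma k + ~~ skip k)%N.
Proof.
have E j : nb_regular A b lambda mu v rho xt yt ybar gamma j
           = (\sum_(i < j) ~~ skip i)%N.
  rewrite /nb_regular -sum1_card big_mkcond.
  by apply: eq_bigr => i _; rewrite inE; case: skip.
by rewrite !E big_ord_recr.
Qed.

Lemma weighted_gap k xs ys :
  2 * rho * (k + nb_regular A b lambda mu v rho xt yt ybar gamma k)%N%:R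
    * (F (x k) (ybar k) - F xs ys)
  <= enorm (ybar 0%N - ys) ^+ 2 - enorm (ybar k - ys) ^+ 2.
Proof.
elim: k => [|k IHk].
  rewrite (_ : nb_regular _ _ _ _ _ _ _ _ _ _ 0 = 0)%N ?mulr0 ?mul0r ?subrr //.
  by apply/eqP; rewrite -leqn0 (leq_trans (max_card _)) ?card_ord.
set N := (k + _)%N in IHk.
(* A regular iteration has weight 2 because the bounds at [y] and at [ybar] add up, the distances at
   [y k.+1] cancelling. *)
have step : 2 * rho * (1 + ~~ skip k)%N%:R * (F (x k.+1) (ybar k.+1) - F xs ys)
            <= enorm (ybar k - ys) ^+ 2 - enorm (ybar k.+1 - ys) ^+ 2.
  have gap1 := ybar_gap k xs ys.
  have [sk|reg] := boolP (skip k).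
    by rewrite mulr1; have [<-] := aplm_s_skip run sk.
  have gap2 := y_gap xs ys reg.
  have : 2 * rho * F (x k.+1) (ybar k.+1) <= 2 * rho * F (x k.+1) (y k.+1).
    by rewrite ler_pM2l ?mulr_gt0 // objective_ybar_le.
  rewrite natrD /=; lra.
(* Monotonicity transfers the accumulated weight [N] to the newest gap. *)
have : 2 * rho * N%:R * F (x k.+1) (ybar k.+1) <= 2 * rho * N%:R * F (x k) (ybar k).
  rewrite ler_wpM2l ?mulr_ge0 ?ler0n ?(ltW rho_gt0) //.
  exact: le_trans (objective_ybar_le k) (objective_y_le k).
have -> : (k.+1 + nb_regular A b lambda mu v rho xt yt ybar gamma k.+1
           = N + (1 + ~~ skip k))%N by rewrite nb_regularS /N; lia.
rewrite natrD; move: IHk step; lra.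
Qed.

End Convergence.

(** * From the Lipschitz hypothesis to the rate *)

Theorem theorem3p1 (R : realType) (n m p : nat)
    (A : 'M[R]_(n, m)) (b : 'cV[R]_n) (lambda mu : R)
    (lambda_gt0 : 0 < lambda) (mu_gt0 : 0 < mu)
    (S : 'I_p -> {set 'I_m})
    (v : 'cV[R]_(\sum_(s < p) #|S s|)%N)
    (L : R)
    (gradL : forall (x : 'cV[R]_m) (y z : 'cV[R]_(\sum_(s < p) #|S s|)%N),
       enorm (grad_y A b mu v x y - grad_y A b mu v x z) <= L * enorm (y - z))
    (rho : R) (rho_gt0 : 0 < rho) (rho_le : rho <= 1 / L)
    (xt x : nat -> 'cV[R]_m)
    (yt y ybar gamma : nat -> 'cV[R]_(\sum_(s < p) #|S s|)%N)
    (run : aplm_s_run A b lambda mu v rho xt yt x y ybar gamma)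
    (xs : 'cV[R]_m) (ys : 'cV[R]_(\sum_(s < p) #|S s|)%N) :
  (argmin (fun z => objective A b lambda mu v z.1 z.2) (xs, ys) <->
   argmin_on [set z | z.1.2 = z.2]
     (fun z => smooth_part A b mu v z.1.1 z.1.2 + group_reg lambda z.2)
     (xs, ys, ys)) /\
  (argmin (fun z => objective A b lambda mu v z.1 z.2) (xs, ys) ->
   forall k : nat, (1 <= k)%N ->
     objective A b lambda mu v (x k) (ybar k) - objective A b lambda mu v xs ys
     <= enorm (ybar 0%N - ys) ^+ 2
        / (2 * rho *
           (k + nb_regular A b lambda mu v rho xt yt ybar gamma k)%N%:R)).
Proof.
split.
  split=> [[_ opt]|[_ opt]].
    by split=> // -[[x1 y1] y2] /= <-; exact: (opt (x1, y1) I).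
  by split=> // -[x1 y1] _; exact: (opt (x1, y1, y1) erefl).
move=> _ k k_gt0.
have L_gt0 : 0 < L by have := lt_le_trans rho_gt0 rho_le; rewrite div1r invr_gt0.
(* The gradient in [y] is affine with linear part [mu^-1], so the Lipschitz bound between [u] and 0
   reads [mu^-1 * enorm u <= L * enorm u]. Keeping the factor [enorm u] avoids the need for a
   nonzero vector. *)
have quadratic_bound (u : 'cV[R]_(\sum_(s < p) #|S s|)%N) :
    mu^-1 * enorm u ^+ 2 <= rho^-1 * enorm u ^+ 2.
  have : L <= rho^-1 by rewrite -[L]invrK lef_pV2 ?posrE ?invr_gt0 // -div1r.
  move=> /(ler_wpM2r (enorm_ge0 u)) L_le.
  rewrite expr2 !mulrA ler_wpM2r ?enorm_ge0 //; apply: le_trans L_le.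
  have := gradL 0 u 0; rewrite !grad_yE mulmx0 !subr0 opprD addrACA subrr add0r.
  by rewrite scaler0 subr0 enormZ ger0_norm // invr_ge0 ltW.
have := weighted_gap lambda_gt0 mu_gt0 rho_gt0 run quadratic_bound k xs ys.
move=> gap; rewrite ler_pdivlMr; last first.
  by rewrite !mulr_gt0 // ltr0n addn_gt0 k_gt0.
rewrite mulrC (le_trans gap) // gerBl sqr_ge0 //.
Qed.
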